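(* Let $\omega(x,y,z) = xyz - yxz + zxy$ (fourth family, $q=1$) and $\omega'(x,y,z) = x(y\circ z)$ with $u\circ v=\tfrac12(uv+vu)$ (Jordan family, $q=1$). Then $U(A^{\omega})\cong U(A^{\omega'})$ as unital associative algebras.
   Context: $\mathbb{F}$ is a field of characteristic $0$. $A$ is the 2-dimensional space of $2\times 2$ matrices over $\mathbb{F}$ with zero diagonal, with basis $e_1 = \begin{bmatrix} 0&1\\0&0\end{bmatrix}$, $e_2 = \begin{bmatrix} 0&0\\1&0\end{bmatrix}$; it is closed under triple products $xyz$ of matrices. For a trilinear operation $\omega(x,y,z)$ (a fixed rational linear combination of the six products of $x,y,z$ in all orders), $A^\omega$ denotes the space $A$ with the trilinear operation $\omega$ computed using matrix multiplication. Let $\mathbb{F}\langle a,b\rangle$ be the free unital associative algebra and $\phi\colon A \to \mathbb{F}\langle a,b\rangle$ the linear map with $\phi(e_1)=a$, $\phi(e_2)=b$. The universal associative envelope is $U(A^\omega) = \mathbb{F}\langle a,b\rangle / I$, where $I$ is the two-sided ideal generated by the elements $\omega(\phi(x),\phi(y),\phi(z)) - \phi(\omega(x,y,z))$ for $x,y,z\in\{e_1,e_2\}$. *)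

(* Defs.v *)
From HB Require Import structures.
From mathcomp Require Import all_boot all_order all_algebra.
From mathcomp Require Import ring_quotient generic_quotient finmap.
From mathcomp.multinomials Require Import monalg.
From mathcomp.classical Require boolp.

Set Implicit Arguments.
Unset Strict Implicit.
Unset Printing Implicit Defensive.

Import GRing.Theory.
Local Open Scope ring_scope.
Local Open Scope quotient_scope.

Fact malg_scalerAr (F : fieldType) (K : monomType) (k : F) (x y : {malg F[K]}) : k *: (x * y) = x * (k *: y).
Proof.
apply/malgP => m; rewrite mcoeffZ.
rewrite (@mcoeffMr _ _ x y m).
rewrite (@mcoeffMrw _ _ (msupp x) (msupp y) x (k *: y) m) //; last first.
  exact: msuppZ_le.
rewrite mulr_sumr.
apply: eq_bigr => k2 _; rewrite mulr_sumr; apply: eq_bigr => k1 _.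
by rewrite mcoeffZ mulrnAr mulrCA.
Qed.

(* The free unital associative algebra on I is the monoid algebra of the free
   monoid on I. *)
Definition freeAlg (F : fieldType) (I : choiceType) := {malg F[{fmonom I}]}.

Section FreeAlg.
Variables (F : fieldType) (I : choiceType).

HB.instance Definition _ := GRing.Lalgebra.on (freeAlg F I).

Fact freeAlg_scalerAr (k : F) (x y : freeAlg F I) : k *: (x * y) = x * (k *: y).
Proof. exact: malg_scalerAr. Qed.

HB.instance Definition _ :=
  GRing.Lalgebra_isAlgebra.Build F (freeAlg F I) freeAlg_scalerAr.

Definition freeGen (i : I) : freeAlg F I := << fmu i >>.

Definition constTerm (x : freeAlg F I) : F := mcoeff (@mone {fmonom I}) x.

Lemma constTerm0 : constTerm 0 = 0.
Proof. exact: mcoeff0. Qed.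
Lemma constTerm1 : constTerm 1 = 1.
Proof. exact: (mcoeffUU (@mone {fmonom I}) (1 : F)). Qed.
Lemma constTermD : {morph constTerm : x y / x + y}.
Proof. exact: mcoeffD. Qed.
Lemma constTermZ k : {morph constTerm : x / k *: x >-> k * x}.
Proof. by move=> x; exact: mcoeffZ. Qed.
Lemma constTermM : {morph constTerm : x y / x * y}.
Proof. exact: (rmorphM (mcoeff (@mone {fmonom I}) : {malg F[{fmonom I}]} -> F)). Qed.
Lemma constTerm_gen i : constTerm (freeGen i) = 0.
Proof.
rewrite /constTerm /freeGen mcoeffU1.
by rewrite fmP fmU fm1.
Qed.

End FreeAlg.

(* An idealr is proper and absorbs multiplication on the left. *)
HB.mixin Record isRightAbsorbing (R : nzRingType) (S : R -> bool) := {
  right_absorbing_subproof : forall u a : R, u \in S -> u * a \in S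
}.

#[short(type="twoSidedIdeal")]
HB.structure Definition TwoSidedIdeal (R : nzRingType) :=
  {S of Idealr R S & isRightAbsorbing R S}.

Definition quotAlg (F : fieldType) (R : algType F) (J : twoSidedIdeal R) :=
  {ideal_quot J}.

Section QuotAlg.
Variables (F : fieldType) (R : algType F) (J : twoSidedIdeal R).
Local Notation Q := (quotAlg J).

HB.instance Definition _ := GRing.Zmodule.on Q.

Definition quotPi (x : R) : Q := \pi_({ideal_quot J}) x.
Definition quotRepr (u : Q) : R := repr (u : {ideal_quot J}).

Lemma quotReprK u : quotPi (quotRepr u) = u.
Proof. exact: reprK. Qed.

Lemma quotPiE x y : (quotPi x = quotPi y) <-> (x - y \in (J : pred R)).
Proof.
by split=> [/eqP|h]; [|apply/eqP]; rewrite -Quotient.idealrBE.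
Qed.

Lemma quotPiD x y : quotPi (x + y) = quotPi x + quotPi y.
Proof. exact: (raddfD (\pi_({ideal_quot J}))). Qed.

Lemma quotReprP x : quotRepr (quotPi x) - x \in (J : pred R).
Proof. by apply/quotPiE; rewrite quotReprK. Qed.

Definition quotOne : Q := quotPi 1.
Definition quotMul (u v : Q) : Q := quotPi (quotRepr u * quotRepr v).
Definition quotScale (k : F) (u : Q) : Q := quotPi (k *: quotRepr u).

Lemma quotPiM x y : quotMul (quotPi x) (quotPi y) = quotPi (x * y).
Proof.
apply/quotPiE; set x' := quotRepr _; set y' := quotRepr _.
have -> : x' * y' - x * y = x' * (y' - y) + (x' - x) * y.
  by rewrite mulrBr mulrBl addrA subrK.
apply: rpredD; first by apply: idealMr; apply: quotReprP.
by apply: right_absorbing_subproof; apply: quotReprP.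
Qed.

Lemma quotPiZ k x : quotScale k (quotPi x) = quotPi (k *: x).
Proof.
apply/quotPiE; rewrite -scalerBr -[_ - _]mul1r scalerAl.
by apply: idealMr; apply: quotReprP.
Qed.

Fact quotMulA : associative quotMul.
Proof.
move=> u v w; rewrite -[u]quotReprK -[v]quotReprK -[w]quotReprK.
by rewrite !quotPiM mulrA.
Qed.
Fact quotMul1 : left_id quotOne quotMul.
Proof. by move=> u; rewrite -[u]quotReprK quotPiM mul1r. Qed.
Fact quotMulr1 : right_id quotOne quotMul.
Proof. by move=> u; rewrite -[u]quotReprK quotPiM mulr1. Qed.
Fact quotMulDl : left_distributive quotMul +%R.
Proof.
move=> u v w; rewrite -[u]quotReprK -[v]quotReprK -[w]quotReprK.
by rewrite -quotPiD !quotPiM mulrDl quotPiD.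
Qed.
Fact quotMulDr : right_distributive quotMul +%R.
Proof.
move=> u v w; rewrite -[u]quotReprK -[v]quotReprK -[w]quotReprK.
by rewrite -quotPiD !quotPiM mulrDr quotPiD.
Qed.
Fact quotOne_neq0 : quotOne != 0.
Proof.
apply/eqP; rewrite -[0]quotReprK => /quotPiE h.
have : 1 \in (J : pred R).
  rewrite -[1](subrK (quotRepr 0)); apply: rpredD => //.
  have : quotPi (quotRepr 0) = quotPi 0.
    by rewrite quotReprK; apply/esym/(raddf0 (\pi_({ideal_quot J}))).
  by move=> /quotPiE; rewrite subr0.
by rewrite idealr1.
Qed.

HB.instance Definition _ := GRing.Zmodule_isNzRing.Build Q
  quotMulA quotMul1 quotMulr1 quotMulDl quotMulDr quotOne_neq0.

Fact quotScaleA a b u : quotScale a (quotScale b u) = quotScale (a * b) u.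
Proof. by rewrite -[u]quotReprK !quotPiZ scalerA. Qed.
Fact quotScale1 : left_id 1 quotScale.
Proof. by move=> u; rewrite -[u]quotReprK quotPiZ scale1r. Qed.
Fact quotScaleDr : right_distributive quotScale +%R.
Proof.
move=> k u v; rewrite -[u]quotReprK -[v]quotReprK.
by rewrite -quotPiD !quotPiZ scalerDr quotPiD.
Qed.
Fact quotScaleDl u : {morph quotScale^~ u : a b / a + b}.
Proof.
by move=> a b; rewrite -[u]quotReprK !quotPiZ scalerDl quotPiD.
Qed.

HB.instance Definition _ := GRing.Zmodule_isLmodule.Build F Q
  quotScaleA quotScale1 quotScaleDr quotScaleDl.

Fact quot_scalerAl (k : F) (u v : Q) : k *: (u * v) = k *: u * v.
Proof.
rewrite -[u]quotReprK -[v]quotReprK /GRing.scale /= /GRing.mul /=.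
by rewrite quotPiM !quotPiZ quotPiM scalerAl.
Qed.
HB.instance Definition _ := GRing.Lmodule_isLalgebra.Build F Q quot_scalerAl.

Fact quot_scalerAr (k : F) (u v : Q) : k *: (u * v) = u * (k *: v).
Proof.
rewrite -[u]quotReprK -[v]quotReprK /GRing.scale /= /GRing.mul /=.
by rewrite quotPiM !quotPiZ quotPiM scalerAr.
Qed.
HB.instance Definition _ := GRing.Lalgebra_isAlgebra.Build F Q quot_scalerAr.

Fact quotPi_is_linear : linear quotPi.
Proof.
by move=> k x y; rewrite quotPiD -quotPiZ.
Qed.
HB.instance Definition _ := GRing.isLinear.Build F R Q *:%R quotPi
  quotPi_is_linear.
Fact quotPi_is_monoid_morphism : monoid_morphism quotPi.
Proof. by split=> // x y; rewrite -quotPiM. Qed.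
HB.instance Definition _ := GRing.isMonoidMorphism.Build R Q quotPi
  quotPi_is_monoid_morphism.

End QuotAlg.

Section IdealGen.
Variable R : nzRingType.

Definition is_two_sided_ideal (J : R -> Prop) : Prop :=
  [/\ J 0, forall x y, J x -> J y -> J (x + y),
      forall a x, J x -> J (a * x) & forall x a, J x -> J (x * a)].

Definition ideal_gen (S : R -> Prop) (x : R) : Prop :=
  forall J, is_two_sided_ideal J -> (forall y, S y -> J y) -> J x.

Lemma ideal_gen_ideal S : is_two_sided_ideal (ideal_gen S).
Proof.
split.
- by move=> J [].
- by move=> x y hx hy J hJ hS; case: (hJ) => _ hD _ _; apply: hD; [apply: hx|apply: hy].
- by move=> a x hx J hJ hS; case: (hJ) => _ _ hl _; apply: hl; apply: hx.
- by move=> x a hx J hJ hS; case: (hJ) => _ _ _ hr; apply: hr; apply: hx.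
Qed.

Lemma ideal_gen_sub (S : R -> Prop) x : S x -> ideal_gen S x.
Proof. by move=> hx J _; apply. Qed.

End IdealGen.

(* Triop c1 c2 c3 c4 c5 c6 stands for
   c1 xyz + c2 xzy + c3 yxz + c4 yzx + c5 zxy + c6 zyx. *)
Record triop := Triop {
  c_xyz : rat; c_xzy : rat; c_yxz : rat; c_yzx : rat; c_zxy : rat; c_zyx : rat
}.

Definition triop_eval (F : fieldType) (R : algType F) (w : triop) (x y z : R) : R :=
  ratr (c_xyz w) *: (x * y * z) + ratr (c_xzy w) *: (x * z * y)
  + ratr (c_yxz w) *: (y * x * z) + ratr (c_yzx w) *: (y * z * x)
  + ratr (c_zxy w) *: (z * x * y) + ratr (c_zyx w) *: (z * y * x).

Section TriopKernel.
Variables (F : fieldType) (R : algType F) (ct : R -> F).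
Hypothesis ctD : {morph ct : x y / x + y}.
Hypothesis ctZ : forall k, {morph ct : x / k *: x >-> k * x}.
Hypothesis ctM : {morph ct : x y / x * y}.

Lemma additive_lincomb0 (k l : F) (x y : R) :
  ct x = 0 -> ct y = 0 -> ct (k *: x + l *: y) = 0.
Proof. by move=> hx hy; rewrite ctD !ctZ hx hy !mulr0 addr0. Qed.

Lemma additive_sub0 (x y : R) : ct x = 0 -> ct y = 0 -> ct (x - y) = 0.
Proof. by move=> hx hy; rewrite -scaleN1r ctD ctZ hx hy mulr0 addr0. Qed.

Lemma triop_eval_ker (w : triop) (x y z : R) :
  ct x = 0 -> ct y = 0 -> ct z = 0 -> ct (triop_eval w x y z) = 0.
Proof.
move=> hx hy hz; rewrite /triop_eval !ctD !ctZ !ctM hx hy hz.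
by rewrite !(mul0r, mulr0, addr0).
Qed.

End TriopKernel.

Definition omega : triop := Triop 1 0 (-1) 0 1 0.

Definition omega' : triop := Triop 2^-1 2^-1 0 0 0 0.

Lemma omegaE (F : fieldType) (R : algType F) (x y z : R) :
  triop_eval omega x y z = x * y * z - y * x * z + z * x * y.
Proof.
rewrite /triop_eval /= (ratr_int F 1) (ratr_int F 0) (ratr_int F (-1)).
by rewrite !scale0r !scale1r scaleN1r !addr0.
Qed.

Definition jordan_mul (F : fieldType) (R : algType F) (u v : R) : R :=
  2^-1 *: (u * v + v * u).

Lemma omega'E (F : fieldType) (R : algType F) (x y z : R) :
  triop_eval omega' x y z = x * jordan_mul y z.
Proof.
have half : ratr 2^-1 = 2^-1 :> F.
  rewrite /ratr (_ : numq 2^-1 = 1) // (_ : denq 2^-1 = 2) // mul1r.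
  by rewrite pmulrn.
rewrite /triop_eval /= half (ratr_int F 0) !scale0r !addr0.
by rewrite /jordan_mul -scalerAr mulrDr scalerDr !mulrA.
Qed.

Section ZeroDiagonal.
Variable F : fieldType.

(* zdiag below is the space A, with basis e1, e2 (see zdiag_basis). *)
Definition zero_diag : pred 'M[F]_2 := [pred M : 'M[F]_2 | [forall i, M i i == 0]].

Lemma zero_diagP (M : 'M[F]_2) : reflect (M 0 0 = 0 /\ M 1 1 = 0) (zero_diag M).
Proof.
apply: (iffP forallP) => [h|[h0 h1] i]; first by split; apply/eqP.
by case: (unliftP ord0 i) => [j ->|->]; rewrite ?ord1; apply/eqP; [rewrite -[RHS]h1|]; 
   rewrite -?[RHS]h0; congr (M _ _); apply/val_inj.
Qed.

Fact zero_diag_submod_closed : GRing.submod_closed zero_diag.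
Proof.
split; first by apply/forallP => i; rewrite mxE.
move=> k M N /forallP hM /forallP hN; apply/forallP => i.
by rewrite !mxE (eqP (hM i)) (eqP (hN i)) mulr0 addr0.
Qed.
HB.instance Definition _ :=
  GRing.isSubmodClosed.Build F 'M[F]_2 zero_diag zero_diag_submod_closed.

Record zdiag := ZDiag { zdiag_val :> 'M[F]_2; zdiagP : zero_diag zdiag_val }.

HB.instance Definition _ := [isSub for zdiag_val].
HB.instance Definition _ := [Choice of zdiag by <:].
HB.instance Definition _ := [SubChoice_isSubLmodule of zdiag by <:].

Lemma zero_diag_mul3 (x y z : 'M[F]_2) :
  zero_diag x -> zero_diag y -> zero_diag z -> zero_diag (x * y * z).
Proof.
move=> /zero_diagP[x0 x1] /zero_diagP[y0 y1] /zero_diagP[z0 z1].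
have E2 (f : 'I_2 -> F) : \sum_i f i = f 0 + f 1.
  by rewrite big_ord_recl big_ord1; congr (_ + f _); apply/val_inj.
apply/zero_diagP; split; rewrite !mxE !E2 !mxE !E2 ?x0 ?x1 ?y0 ?y1 ?z0 ?z1;
  by rewrite !(mul0r, mulr0, addr0, add0r).
Qed.

Lemma zero_diagD (M N : 'M[F]_2) :
  zero_diag M -> zero_diag N -> zero_diag (M + N).
Proof.
have [_ h] := zero_diag_submod_closed; move=> hM hN.
by have := h 1 M N hM hN; rewrite scale1r.
Qed.

Lemma zero_diagZ k (M : 'M[F]_2) : zero_diag M -> zero_diag (k *: M).
Proof.
have [h0 h] := zero_diag_submod_closed; move=> hM.
by have := h k M 0 hM h0; rewrite addr0.
Qed.

Lemma zero_diag_triop (w : triop) (x y z : zdiag) :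
  zero_diag (triop_eval w (x : 'M[F]_2) (y : 'M[F]_2) (z : 'M[F]_2)).
Proof.
have P k (a b c : zdiag) : zero_diag (k *: ((a : 'M[F]_2) * (b : 'M[F]_2) * (c : 'M[F]_2))).
  by apply: zero_diagZ; apply: zero_diag_mul3; apply: zdiagP.
by do 5![apply: zero_diagD; last exact: P]; exact: P.
Qed.

(* A^w is the space zdiag with this operation; w is computed in 'M[F]_2. *)
Definition zdiag_op (w : triop) (x y z : zdiag) : zdiag :=
  ZDiag (zero_diag_triop w x y z).

Fact zero_diag_e1 : zero_diag (delta_mx 0 1).
Proof. by apply/zero_diagP; rewrite !mxE. Qed.
Fact zero_diag_e2 : zero_diag (delta_mx 1 0).
Proof. by apply/zero_diagP; rewrite !mxE. Qed.

Definition e1 : zdiag := ZDiag zero_diag_e1.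
Definition e2 : zdiag := ZDiag zero_diag_e2.

Lemma zdiag_basis (x : zdiag) : x = x 0 1 *: e1 + x 1 0 *: e2.
Proof.
apply/val_inj/matrixP => i j; rewrite /= !mxE.
have [h0 h1] := zero_diagP _ (zdiagP x).
have I2 (k : 'I_2) : k = 0 \/ k = 1.
  by case: k => [[|[|//]]] k; [left|right]; apply/val_inj.
by case: (I2 i) => ->; case: (I2 j) => ->;
  rewrite /= ?mulr0 ?mulr1 ?addr0 ?add0r.
Qed.

Local Notation Fab := (freeAlg F 'I_2).

(* The generators a, b are freeGen F 0, freeGen F 1. *)
Definition phi (x : zdiag) : Fab := x 0 1 *: freeGen F 0 + x 1 0 *: freeGen F 1.

Fact phi_linear_aux (V : lmodType F) (k a b c d : F) (u v : V) :
  (k * a + b) *: u + (k * c + d) *: v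
  = k *: (a *: u + c *: v) + (b *: u + d *: v).
Proof. by rewrite !scalerDl scalerDr !scalerA addrACA. Qed.

Fact phi_is_linear : linear phi.
Proof.
move=> k x y; rewrite {1}/phi.
have -> : (k *: x + y) 0 1 = k * x 0 1 + y 0 1 by rewrite !mxE.
have -> : (k *: x + y) 1 0 = k * x 1 0 + y 1 0 by rewrite !mxE.
exact: phi_linear_aux.
Qed.
HB.instance Definition _ := GRing.isLinear.Build F zdiag Fab *:%R phi phi_is_linear.

Lemma phi_e1 : phi e1 = freeGen F 0.
Proof. by rewrite /phi /= !mxE /= scale1r scale0r addr0. Qed.
Lemma phi_e2 : phi e2 = freeGen F 1.
Proof. by rewrite /phi /= !mxE /= scale1r scale0r add0r. Qed.

Definition env_rel (w : triop) (r : Fab) : Prop :=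
  exists x y z : zdiag,
    [/\ x \in [:: e1; e2], y \in [:: e1; e2], z \in [:: e1; e2] &
        r = triop_eval w (phi x) (phi y) (phi z) - phi (zdiag_op w x y z)].

Definition env_ideal (w : triop) : Fab -> bool :=
  fun r => boolp.asbool (ideal_gen (env_rel w) r).

Lemma env_idealP w r : reflect (ideal_gen (env_rel w) r) (r \in env_ideal w).
Proof. exact: boolp.asboolP. Qed.

(* The constant term of a generator vanishes, so the ideal is proper. *)
Lemma env_ideal_constTerm w (r : Fab) : ideal_gen (env_rel w) r -> constTerm r = 0.
Proof.
move=> h; apply: (h (fun u => constTerm u = 0)).
  split=> [|u v hu hv|a u hu|u a hu]; first exact: constTerm0.
  - by rewrite constTermD hu hv addr0.
  - by rewrite constTermM hu mulr0.
  - by rewrite constTermM hu mul0r.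
move=> _ [x [y [z [_ _ _ ->]]]].
have phi0 t : constTerm (phi t) = 0.
  apply: (additive_lincomb0 (@constTermD _ _) (@constTermZ _ _));
    exact: constTerm_gen.
apply: (additive_sub0 (@constTermD _ _) (@constTermZ _ _)); last exact: phi0.
by apply: (triop_eval_ker (@constTermD _ _) (@constTermZ _ _) (@constTermM _ _));
  exact: phi0.
Qed.

Fact env_ideal_closed w : idealr_closed (env_ideal w).
Proof.
have [h0 hD hl hr] := ideal_gen_ideal (env_rel w).
split; first exact/env_idealP.
- apply/env_idealP => /env_ideal_constTerm /eqP.
  by rewrite constTerm1 oner_eq0.
- move=> a u v /env_idealP hu /env_idealP hv; apply/env_idealP.
  by apply: hD => //; apply: hl.
Qed.
HB.instance Definition _ w := isIdealr.Build Fab (env_ideal w) (env_ideal_closed w).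

Fact env_ideal_right w (u a : Fab) : u \in env_ideal w -> u * a \in env_ideal w.
Proof.
by move=> /env_idealP hu; apply/env_idealP; have [_ _ _] := ideal_gen_ideal (env_rel w); apply.
Qed.
HB.instance Definition _ w :=
  isRightAbsorbing.Build Fab (env_ideal w) (@env_ideal_right w).

End ZeroDiagonal.

Definition univEnv (F : fieldType) (w : triop) : algType F :=
  quotAlg (env_ideal (F := F) w).

Definition alg_isomorphic (F : fieldType) (R S : algType F) : Prop :=
  exists f : {lrmorphism R -> S}, bijective f.

(* Main.v *)
(** The space spanned by the generators is two-dimensional, so every triple of
    basis vectors has a repeated entry. On triples with a repeated entry the
    two operations determine each other linearly in every associative algebra,
    in particular both in the free algebra and in the algebra of matrices.
    Hence the two sets of defining relations generate the same ideal. *)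
Require Import Defs.
From mathcomp Require Import all_boot all_order all_algebra.
From HB Require Import structures.
From mathcomp Require Import ring_quotient.
Import GRing.Theory.
Local Open Scope ring_scope.

Section QuotAlgMap.
Variables (F : fieldType) (R : algType F) (J K : twoSidedIdeal R).

(** The inclusion is an argument, so that the morphism structures depending on it can be inferred
    from the term [quotAlgMap sJK]. *)
Definition quotAlgMap of {subset (J : pred R) <= (K : pred R)} :=
  fun u : quotAlg J => quotPi K (quotRepr u).

Hypothesis sJK : {subset (J : pred R) <= (K : pred R)}.

(** The chosen representative of the class of [x] differs from [x] by an element of [J], hence of
    [K]. *)
Lemma quotAlgMapPi x : quotAlgMap sJK (quotPi J x) = quotPi K x.
Proof. by apply/quotPiE/sJK; apply: quotReprP. Qed.

Fact quotAlgMap_is_linear : linear (quotAlgMap sJK).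
Proof.
move=> k u v; rewrite -[u]quotReprK -[v]quotReprK.
by rewrite -linearP !quotAlgMapPi linearP.
Qed.
HB.instance Definition _ := GRing.isLinear.Build F (quotAlg J) (quotAlg K)
  *:%R (quotAlgMap sJK) quotAlgMap_is_linear.

Fact quotAlgMap_is_monoid_morphism : monoid_morphism (quotAlgMap sJK).
Proof.
split=> [|u v]; first by rewrite -(rmorph1 (quotPi J)) quotAlgMapPi rmorph1.
rewrite -[u]quotReprK -[v]quotReprK.
by rewrite -rmorphM !quotAlgMapPi rmorphM.
Qed.
HB.instance Definition _ := GRing.isMonoidMorphism.Build (quotAlg J) (quotAlg K)
  (quotAlgMap sJK) quotAlgMap_is_monoid_morphism.

End QuotAlgMap.

Lemma quotAlgMapK (F : fieldType) (R : algType F) (J K : twoSidedIdeal R)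
    (sJK : {subset (J : pred R) <= (K : pred R)})
    (sKJ : {subset (K : pred R) <= (J : pred R)}) :
  cancel (quotAlgMap _ _ _ _ sJK) (quotAlgMap _ _ _ _ sKJ).
Proof. by move=> u; rewrite [LHS]quotAlgMapPi quotReprK. Qed.

Lemma eq_ideal_quotAlg_iso (F : fieldType) (R : algType F)
    (J K : twoSidedIdeal R) :
  {subset (J : pred R) <= (K : pred R)} ->
  {subset (K : pred R) <= (J : pred R)} ->
  alg_isomorphic (quotAlg J) (quotAlg K).
Proof.
move=> sJK sKJ; exists (quotAlgMap _ _ _ _ sJK).
by exists (quotAlgMap _ _ _ _ sKJ); apply: quotAlgMapK.
Qed.

Lemma two_neq0_pchar0 (F : fieldType) (charF0 : [pchar F] =i pred0) : (2 : F) != 0.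
Proof. by rewrite (proj1 (pcharf0P F) charF0 2). Qed.

(** With [phi] for [f], this carries a linear relation between two operations over to their
    relators. *)
Lemma sub_linear_comb (F : fieldType) (U V : lmodType F) (f : {linear U -> V})
    (k : F) (a b : V) (c d : U) :
  k *: a - b - f (k *: c - d) = k *: (a - f c) - (b - f d).
Proof. by rewrite linearB linearZ scalerBr !opprD !opprK addrACA. Qed.

Section RepeatedArgument.
Variables (F : fieldType) (charF0 : [pchar F] =i pred0) (R : algType F).
Implicit Types x y z : R.

Let two_neq0 := two_neq0_pchar0 _ charF0.

Lemma triop_eval_omega'C x y z :
  triop_eval omega' x y z = triop_eval omega' x z y.
Proof. by rewrite !omega'E /jordan_mul addrC. Qed.

(** Since 2 is invertible, the Jordan square of [x] is [x * x]. *)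
Lemma triop_eval_omega'_diag x y : triop_eval omega' y x x = y * x * x.
Proof.
rewrite omega'E /jordan_mul -mulr2n -scaler_nat scalerA mulVf //.
by rewrite scale1r mulrA.
Qed.

Lemma triop_eval_omega_xxy x y :
  triop_eval omega x x y = triop_eval omega' y x x.
Proof. by rewrite omegaE triop_eval_omega'_diag subrr add0r. Qed.

Lemma triop_eval_omega_yxx x y :
  triop_eval omega y x x = triop_eval omega' y x x.
Proof. by rewrite omegaE triop_eval_omega'_diag subrK. Qed.

(** The left side is [xyx - yxx + xxy], and doubling [omega'] at [x, x, y] gives [xxy + xyx]. *)
Lemma triop_eval_omega_xyx x y :
  triop_eval omega x y x
  = (2 : F) *: triop_eval omega' x x y - triop_eval omega' y x x.
Proof.
rewrite triop_eval_omega'_diag omegaE omega'E /jordan_mul -scalerAr scalerA.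
by rewrite divff // scale1r mulrDr !mulrA addrAC [x * y * x + _]addrC.
Qed.

End RepeatedArgument.

Section EnvelopeRelations.
Variables (F : fieldType) (charF0 : [pchar F] =i pred0).
Implicit Types x y z : zdiag F.

Let two_neq0 := two_neq0_pchar0 _ charF0.

Definition relator (w : triop) x y z : freeAlg F 'I_2 :=
  triop_eval w (phi x) (phi y) (phi z) - phi (zdiag_op w x y z).

(** As [zdiag_op] is computed on matrices, this and the next three identities are the preceding ones
    in the matrix algebra. *)
Lemma zdiag_op_omega'C x y z : zdiag_op omega' x y z = zdiag_op omega' x z y.
Proof. by apply/val_inj/(triop_eval_omega'C F _ (zdiag_val x)). Qed.

Lemma zdiag_op_omega_xxy x y : zdiag_op omega x x y = zdiag_op omega' y x x.
Proof. by apply/val_inj/(triop_eval_omega_xxy F _ _ (zdiag_val x)). Qed.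

Lemma zdiag_op_omega_yxx x y : zdiag_op omega y x x = zdiag_op omega' y x x.
Proof. by apply/val_inj/(triop_eval_omega_yxx F _ _ (zdiag_val x)). Qed.

Lemma zdiag_op_omega_xyx x y :
  zdiag_op omega x y x
  = (2 : F) *: zdiag_op omega' x x y - zdiag_op omega' y x x.
Proof. by apply/val_inj/(triop_eval_omega_xyx F _ _ (zdiag_val x)). Qed.

(* Rewriting with the operation identities instead would make unification
   compare distinct elements of the free algebra by unfolding them. *)
Lemma relator_omega'C x y z : relator omega' x y z = relator omega' x z y.
Proof.
exact: (congr2 (fun r t => r - phi t) (triop_eval_omega'C _ _ _ _ _)
  (zdiag_op_omega'C x y z)).
Qed.

Lemma relator_omega_xxy x y : relator omega x x y = relator omega' y x x.
Proof.
exact: (congr2 (fun r t => r - phi t) (triop_eval_omega_xxy _ charF0 _ _ _)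
  (zdiag_op_omega_xxy x y)).
Qed.

Lemma relator_omega_yxx x y : relator omega y x x = relator omega' y x x.
Proof.
exact: (congr2 (fun r t => r - phi t) (triop_eval_omega_yxx _ charF0 _ _ _)
  (zdiag_op_omega_yxx x y)).
Qed.

Lemma relator_omega_xyx x y :
  relator omega x y x = (2 : F) *: relator omega' x x y - relator omega' y x x.
Proof.
apply: etrans (congr2 (fun r t => r - phi t)
  (triop_eval_omega_xyx _ charF0 _ _ _) (zdiag_op_omega_xyx x y)) _.
exact: sub_linear_comb.
Qed.

(** This inverts [relator_omega_xyx], whose term [relator omega' y x x] equals
    [relator omega x x y]. *)
Lemma relator_omega'_xxy x y :
  relator omega' x x y
  = (2^-1 : F) *: (relator omega x y x + relator omega x x y).
Proof.
by rewrite relator_omega_xyx relator_omega_xxy subrK scalerA mulVf // scale1r.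
Qed.

(** Pigeonhole: three entries taken from two basis vectors cannot be pairwise distinct. *)
Lemma basis_triple_ind (P : zdiag F -> zdiag F -> zdiag F -> Prop) :
  (forall x y, x \in [:: e1 F; e2 F] -> y \in [:: e1 F; e2 F] ->
    [/\ P x x y, P x y x & P y x x]) ->
  forall x y z, x \in [:: e1 F; e2 F] -> y \in [:: e1 F; e2 F] ->
    z \in [:: e1 F; e2 F] -> P x y z.
Proof.
move=> hP x y z hx hy hz.
have [xy xz yz] : [/\ P x x z, P x y x & P x y y].
  have [? ? _] := hP x z hx hz; have [_ ? _] := hP x y hx hy.
  by have [_ _ ?] := hP y x hy hx.
(* In each of the eight cases two entries agree, so one of the three instances above is the goal. *)
move: hx hy hz; rewrite !inE => /orP[]/eqP ex /orP[]/eqP ey /orP[]/eqP ez.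
all: by move: xy xz yz; rewrite ex ey ez.
Qed.

(** By minimality of the generated ideal, it suffices to test the generators. *)
Lemma env_ideal_sub (w w' : triop) :
  (forall x y z, x \in [:: e1 F; e2 F] -> y \in [:: e1 F; e2 F] ->
    z \in [:: e1 F; e2 F] -> relator w x y z \in env_ideal w') ->
  {subset env_ideal (F := F) w <= env_ideal w'}.
Proof.
move=> h r /env_idealP hr; apply/env_idealP.
apply: (hr (ideal_gen (env_rel w'))); first exact: ideal_gen_ideal.
by move=> _ [x [y [z [hx hy hz ->]]]]; apply/env_idealP; apply: h.
Qed.

Lemma relator_env_ideal (w : triop) x y z :
  x \in [:: e1 F; e2 F] -> y \in [:: e1 F; e2 F] -> z \in [:: e1 F; e2 F] ->
  relator w x y z \in env_ideal w.
Proof.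
move=> hx hy hz; apply/env_idealP.
by apply: (@ideal_gen_sub _ (env_rel w)); exists x, y, z.
Qed.

Lemma env_idealZ (w : triop) (k : F) (r : freeAlg F 'I_2) :
  r \in env_ideal w -> k *: r \in env_ideal w.
Proof. by move=> hr; rewrite -[r]mul1r scalerAl idealMr. Qed.

Lemma env_ideal_omega_sub : {subset env_ideal (F := F) omega <= env_ideal omega'}.
Proof.
apply: env_ideal_sub; apply: basis_triple_ind => x y hx hy.
split; rewrite ?relator_omega_xxy ?relator_omega_xyx ?relator_omega_yxx.
- exact: relator_env_ideal.
- by apply: rpredB; [apply: env_idealZ|]; apply: relator_env_ideal.
- exact: relator_env_ideal.
Qed.

Lemma env_ideal_omega'_sub : {subset env_ideal (F := F) omega' <= env_ideal omega}.
Proof.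
apply: env_ideal_sub; apply: basis_triple_ind => x y hx hy.
have xxy : relator omega' x x y \in env_ideal omega.
  rewrite relator_omega'_xxy; apply: env_idealZ.
  by apply: rpredD; apply: relator_env_ideal.
(* The pattern [x y x] reduces to [x x y] by the symmetry of [omega'] in its last two arguments. *)
split; [exact: xxy | rewrite relator_omega'C; exact: xxy |].
by rewrite -relator_omega_xxy; apply: relator_env_ideal.
Qed.

End EnvelopeRelations.

Theorem proposition5p9 (F : fieldType) (charF0 : [pchar F] =i pred0) :
  alg_isomorphic (univEnv F omega) (univEnv F omega').
Proof.
apply: eq_ideal_quotAlg_iso; first exact: env_ideal_omega_sub.
exact: env_ideal_omega'_sub.
Qed.
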